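(* Let $\Sigma$ be an Ehrhart fan, purely $d$-dimensional and balanced. If $\varphi_{\frac{1}{1-t}}$ descends to an isomorphism $\mathbb{Q}K_{\mathrm{Ehr}_\Sigma}\cong\mathbb{Q}A_{\mathrm{Vol}_\Sigma}$, then the exceptional Todd class $\mathrm{td}_{\mathrm{ex}}$ is represented by the all-ones Minkowski weight $\Sigma\ni\sigma\mapsto1\in\mathbb{Q}$. In particular, all skeleta of $\Sigma$ are balanced.
   Context: $N$ is a lattice with dual $M=\mathrm{Hom}(N,\mathbb{Z})$, and $\Sigma$ is a unimodular (smooth), not necessarily complete, rational polyhedral fan in $N_{\mathbb{Q}}$; $\Sigma(k)$ is its set of $k$-dimensional cones, $u_\rho$ the primitive generator of $\rho\in\Sigma(1)$. $\mathrm{PL}(\Sigma)$ is the group of piecewise linear functions on the support of $\Sigma$, linear on each cone and integral at every $u_\rho$; it is free with basis the Courant functions $x_\rho$, $x_\rho(u_{\rho'})=\delta_{\rho\rho'}$; $M\to\mathrm{PL}(\Sigma)$ is $m\mapsto\sum_\rho\langle m,u_\rho\rangle x_\rho$. The rational Chow ring $\mathbb{Q}A(\Sigma)$ is the quotient of $\mathbb{Q}[x_\rho:\rho\in\Sigma(1)]$ by the ideal generated by the products $\prod_{\rho\in I}x_\rho$ for $I\subseteq\Sigma(1)$ not spanning a cone and the linear forms coming from $M$. A $k$-dimensional Minkowski weight is a map $w\colon\Sigma(k)\to\mathbb{Q}$ such that for every $\tau\in\Sigma(k-1)$, $\sum_{\sigma\in\Sigma(k),\sigma\supset\tau}w(\sigma)u_{\sigma\setminus\tau}\in\mathrm{span}(\tau)$,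 where $u_{\sigma\setminus\tau}$ is the generator of the ray of $\sigma$ not in $\tau$. There is an isomorphism between $\mathrm{Hom}(\mathbb{Q}A^k(\Sigma),\mathbb{Q})$ and $k$-dimensional Minkowski weights, $\psi\mapsto(\sigma\mapsto\psi(\prod_{\rho\in\sigma(1)}x_\rho))$. The $k$-skeleton of $\Sigma$ is balanced if $\sigma\mapsto1$ on $\Sigma(k)$ is a Minkowski weight. $\Sigma$ purely $d$-dimensional is balanced if this holds for $k=d$; then $\deg\colon\mathbb{Q}A(\Sigma)\to\mathbb{Q}$ is the functional corresponding to the constant weight $1$ on $\Sigma(d)$ (zero in other degrees) and $\mathrm{Vol}_\Sigma(f)=\frac1{d!}\deg(f^d)$, a polynomial on $\mathrm{PL}(\Sigma)$. Star fan: $\Sigma^\rho$ is the fan in $(N/\mathbb{Z}u_\rho)_{\mathbb{Q}}$ of images of cones containing $\rho$; for $f\in\mathrm{PL}(\Sigma)$, $f^\rho\in\mathrm{PL}(\Sigma^\rho)/\mathrm{Hom}(N/\mathbb{Z}u_\rho,\mathbb{Z})$ is the class induced by $f-m$ on cones containing $\rho$, for any $m\in M$ with $\langle m,u_\rho\rangle=f(u_\rho)$. Ehrhart fans are defined recursively: the zero-dimensional fan is Ehrhart with $\mathrm{Ehr}=1$; $\Sigma$ of positive dimension is Ehrhart if every $\Sigma^\rho$ is Ehrhart and there is a (unique) $M$-invariant function $\mathrm{Ehr}_\Sigma\colon\mathrm{PL}(\Sigma)\to\mathbb{Z}$ with $\mathrm{Ehr}_\Sigma(0)=1$ and $\mathrm{Ehr}_\Sigma(f)-\mathrm{Ehr}_\Sigma(f-x_\rho)=\mathrm{Ehr}_{\Sigma^\rho}(f^\rho)$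 for all $f,\rho$. It is a polynomial function. With $\Lambda=\mathrm{PL}(\Sigma)$: $\mathrm{Sh}(\Lambda)=\mathbb{Z}[\Lambda]$ has basis $T^u$ acting by $(T^uh)(x)=h(x+u)$; $\mathrm{Diff}(\Lambda)=\mathbb{Z}[\partial_\rho:\rho\in\Sigma(1)]$ with $\partial_\rho$ the derivative in direction $x_\rho$; $K_f=\mathrm{Sh}(\Lambda)/\mathrm{Ann}(f)$, $A_g=\mathrm{Diff}(\Lambda)/\mathrm{Ann}(g)$ for polynomials $f,g$ on $\Lambda$ ($\mathrm{Ann}$: ideal of operators killing the polynomial), $\chi_f(E)=(E\cdot f)(0)$, $\deg_g([D])=(D\cdot g)(0)$, $\mathbb{Q}R=\mathbb{Q}\otimes R$. The assignment $x_\rho\mapsto[\partial_\rho]$ gives a surjection $\mathbb{Q}A(\Sigma)\to\mathbb{Q}A_{\mathrm{Vol}_\Sigma}$ under which $\deg$ corresponds to $\deg_{\mathrm{Vol}_\Sigma}$. $\varphi_{\frac1{1-t}}\colon\mathbb{Q}\,\mathrm{Sh}(\Lambda)\to\mathbb{Q}A_{\mathrm{Vol}_\Sigma}$ is the $\mathbb{Q}$-algebra homomorphism with $T^{x_\rho}\mapsto\frac1{1-[\partial_\rho]}$ (i.e. $1-T^{-x_\rho}\mapsto[\partial_\rho]$). If it descends to an isomorphism $\mathbb{Q}K_{\mathrm{Ehr}_\Sigma}\cong\mathbb{Q}A_{\mathrm{Vol}_\Sigma}$, the exceptional Todd class is the unique $\mathrm{td}_{\mathrm{ex}}\in(\mathbb{Q}A_{\mathrm{Vol}_\Sigma})^\times$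 with $\chi_{\mathrm{Ehr}_\Sigma}(E)=\deg_{\mathrm{Vol}_\Sigma}(\mathrm{td}_{\mathrm{ex}}\cdot\varphi_{\frac1{1-t}}(E))$ for all $E$. It is represented by the Minkowski weights $w_k$ on $\Sigma(k)$, $k\ge0$, corresponding to the functional $a\mapsto\deg_{\mathrm{Vol}_\Sigma}(\mathrm{td}_{\mathrm{ex}}\cdot a)$ on $\mathbb{Q}A(\Sigma)$. *)

(* Defs.v *)
From HB Require Import structures.
From mathcomp Require Import all_boot all_order all_algebra.
From mathcomp Require Import finmap boolp.
From mathcomp Require monalg.
From mathcomp Require Import mpoly.

Set Implicit Arguments.
Unset Strict Implicit.
Unset Printing Implicit Defensive.

Import GRing.Theory Num.Theory.
Import Quotient.Exports.

Local Open Scope ring_scope.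
Local Open Scope quotient_scope.

(* The quotient of a commutative algebra by an ideal.  ring_quotient only     *)
(* handles proper ideals; here the quotient may be the zero ring, hence the   *)
(* instances below are those of a possibly zero commutative ring and of a     *)
(* module over the scalars.                                                   *)

Definition ideal_closed (R : comNzRingType) (S : {pred R}) : Prop :=
  zmod_closed S /\ forall a, {in S, forall u, a * u \in S}.

Record ideal (R : comNzRingType) := Ideal {
  ideal_pred :> R -> bool;
  idealP : ideal_closed ideal_pred
}.

HB.instance Definition _ (R : comNzRingType) (I : ideal R) :=
  GRing.isZmodClosed.Build R (ideal_pred I) (idealP I).1.

Section QuotientAlgebra.
Variables (K : comNzRingType) (R : comAlgType K) (I : ideal R).

Definition qalg := Quotient.quot (GRing.ZmodClosed.clone R (ideal_pred I) _).

HB.instance Definition _ := GRing.Zmodule.on qalg.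

Definition qproj (x : R) : qalg := \pi_qalg x.

Lemma qprojP x y : reflect (qproj x = qproj y) (x - y \in ideal_pred I).
Proof. by rewrite /qproj (Quotient.idealrBE (GRing.ZmodClosed.clone R (ideal_pred I) _)); apply: eqP. Qed.

Lemma qproj_repr (a : qalg) : qproj (repr a) = a.
Proof. exact: reprK. Qed.

Lemma qproj_surj (a : qalg) : exists x, a = qproj x.
Proof. by exists (repr a); rewrite qproj_repr. Qed.

Lemma idealMl a u : u \in ideal_pred I -> a * u \in ideal_pred I.
Proof. exact: (idealP I).2. Qed.

Fact qproj_is_zmod_morphism : zmod_morphism qproj.
Proof. by move=> x y; rewrite /qproj raddfB. Qed.

HB.instance Definition _ :=
  GRing.isZmodMorphism.Build R qalg qproj qproj_is_zmod_morphism.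

Definition qone : qalg := qproj 1.
Definition qmul (a b : qalg) : qalg := qproj (repr a * repr b).
Definition qscale (c : K) (a : qalg) : qalg := qproj (c *: repr a).

Fact qmulE x y : qmul (qproj x) (qproj y) = qproj (x * y).
Proof.
apply/qprojP.
have hx : x - repr (qproj x) \in ideal_pred I by apply/qprojP; rewrite qproj_repr.
have hy : y - repr (qproj y) \in ideal_pred I by apply/qprojP; rewrite qproj_repr.
rewrite -rpredN opprB.
have -> : x * y - repr (qproj x) * repr (qproj y) =
  y * (x - repr (qproj x)) + repr (qproj x) * (y - repr (qproj y)).
  by rewrite !mulrBr (mulrC y x) (mulrC y (repr _)) addrA addrNK.
by rewrite rpredD ?idealMl.
Qed.

Fact qscaleE c x : qscale c (qproj x) = qproj (c *: x).
Proof.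
apply/qprojP.
rewrite -scalerBr -[X in c *: X]mul1r scalerAl idealMl //.
by apply/qprojP; rewrite qproj_repr.
Qed.

Fact qmulA : associative qmul.
Proof.
move=> a b c; have [[x ->] [y ->] [z ->]] := And3 (qproj_surj a) (qproj_surj b) (qproj_surj c).
by rewrite !qmulE mulrA.
Qed.

Fact qmulC : commutative qmul.
Proof. by move=> a b; rewrite /qmul mulrC. Qed.

Fact qmul1 : left_id qone qmul.
Proof. by move=> a; have [x ->] := qproj_surj a; rewrite qmulE mul1r. Qed.

Fact qmulDl : left_distributive qmul +%R.
Proof.
move=> a b c; have [[x ->] [y ->] [z ->]] := And3 (qproj_surj a) (qproj_surj b) (qproj_surj c).
by rewrite -raddfD !qmulE mulrDl raddfD.
Qed.

HB.instance Definition _ :=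
  GRing.Zmodule_isComPzRing.Build qalg qmulA qmulC qmul1 qmulDl.

Fact qscaleA c d a : qscale c (qscale d a) = qscale (c * d) a.
Proof. by have [x ->] := qproj_surj a; rewrite !qscaleE scalerA. Qed.

Fact qscale1 a : qscale 1 a = a.
Proof. by have [x ->] := qproj_surj a; rewrite qscaleE scale1r. Qed.

Fact qscaleDr : right_distributive qscale +%R.
Proof.
move=> c a b; have [[x ->] [y ->]] := conj (qproj_surj a) (qproj_surj b).
by rewrite -raddfD !qscaleE scalerDr raddfD.
Qed.

Fact qscaleDl a : {morph qscale^~ a : c d / c + d}.
Proof. by move=> c d; have [x ->] := qproj_surj a; rewrite !qscaleE scalerDl raddfD. Qed.

HB.instance Definition _ :=
  GRing.Zmodule_isLmodule.Build K qalg qscaleA qscale1 qscaleDr qscaleDl.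

Fact qproj_is_monoid_morphism : monoid_morphism qproj.
Proof. by split=> // x y; rewrite -qmulE. Qed.

HB.instance Definition _ :=
  GRing.isMonoidMorphism.Build R qalg qproj qproj_is_monoid_morphism.

Fact qproj_is_scalable : scalable qproj.
Proof. by move=> c x; rewrite -qscaleE. Qed.

HB.instance Definition _ :=
  GRing.isScalable.Build K R qalg _ qproj qproj_is_scalable.

End QuotientAlgebra.

(* The rational group algebra of an additive group, with basis T^u, u in G.   *)
(* (monalg gives a ring structure to {malg rat[G]} only when the exponents    *)
(* form a monoid without nontrivial units.)                                   *)

Section GroupAlgebra.
Import monalg.
Variable G : zmodType.

Definition grpalg := monalg.malg G rat.

HB.instance Definition _ := GRing.Lmodule.on grpalg.

Local Notation coef := monalg.mcoeff.
Local Notation supp := monalg.msupp.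
Local Notation mono := monalg.mkmalgU.

Definition shift (u : G) : grpalg := monalg.mkmalgU u 1.

Definition gmul (a b : grpalg) : grpalg :=
  \sum_(u <- supp a) \sum_(v <- supp b) mono (u + v) (coef u a * coef v b).

Local Notation term a b := (fun u v => mono (u + v) (coef u a * coef v b)).

Fact gmulwl (a b : grpalg) (d1 d2 : {fset G}) :
    (supp a `<=` d1)%fset -> (supp b `<=` d2)%fset ->
  gmul a b = \sum_(u <- d1) \sum_(v <- d2) term a b u v.
Proof.
move=> le1 le2; rewrite /gmul (big_fset_incl _ le1) /=.
  apply/eq_bigr=> u _; apply/big_fset_incl => // v _ /monalg.mcoeff_outdom ->.
  by rewrite mulr0 monalg.monalgU0.
move=> u _ /monalg.mcoeff_outdom au.
by rewrite big1 => // v _; rewrite au mul0r monalg.monalgU0.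
Qed.

Fact gmulC : commutative gmul.
Proof.
move=> a b; rewrite /gmul exchange_big /=; apply/eq_bigr => u _.
by apply/eq_bigr => v _; rewrite addrC mulrC.
Qed.

Fact gmulDl : left_distributive gmul +%R.
Proof.
move=> a b c; pose d := (supp a `|` supp b)%fset.
rewrite (gmulwl (monalg.msuppD_le a b) (fsubset_refl _)).
rewrite (gmulwl (fsubsetUl _ (supp b)) (fsubset_refl _)).
rewrite (gmulwl (fsubsetUr (supp a) _) (fsubset_refl _)) -big_split /=.
apply/eq_bigr=> u _; rewrite -big_split /=; apply/eq_bigr=> v _.
by rewrite monalg.mcoeffD mulrDl monalg.monalgUD.
Qed.

Fact gmulDr : right_distributive gmul +%R.
Proof. by move=> a b c; rewrite gmulC gmulDl !(gmulC a). Qed.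

Fact gmul0l a : gmul 0 a = 0.
Proof. by rewrite /gmul monalg.msupp0 big_seq_fset0. Qed.

Fact gmul0r a : gmul a 0 = 0.
Proof. by rewrite gmulC gmul0l. Qed.

Fact gmulUU x y u v : gmul (mono u x) (mono v y) = mono (u + v) (x * y).
Proof.
by rewrite (gmulwl monalg.msuppU_le monalg.msuppU_le) !big_seq_fset1 !monalg.mcoeffUU.
Qed.

Lemma grpalg_ind (P : grpalg -> Prop) :
    P 0 -> (forall a b, P a -> P b -> P (a + b)) ->
    (forall u x, P (mono u x)) -> forall a, P a.
Proof. by move=> P0 PD PU a; rewrite (monalgE a); apply: big_ind. Qed.

Fact gmulA : associative gmul.
Proof.
elim/grpalg_ind=> [b c|a1 a2 IH1 IH2 b c|u x].
- by rewrite !gmul0l.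
- by rewrite !gmulDl IH1 IH2.
elim/grpalg_ind=> [c|b1 b2 IH1 IH2 c|v y].
- by rewrite !(gmul0l, gmul0r).
- by rewrite !(gmulDl, gmulDr) IH1 IH2.
elim/grpalg_ind=> [|c1 c2 IH1 IH2|w z].
- by rewrite !gmul0r.
- by rewrite !gmulDr IH1 IH2.
by rewrite !gmulUU addrA mulrA.
Qed.

Fact gmul1 : left_id (shift 0) gmul.
Proof.
elim/grpalg_ind=> [|a b IHa IHb|u x]; first exact: gmul0r.
  by rewrite gmulDr IHa IHb.
by rewrite gmulUU add0r mul1r.
Qed.

Fact gone_neq0 : shift 0 != 0.
Proof. by rewrite /shift monalg.monalgU_eq0 oner_eq0. Qed.

HB.instance Definition _ :=
  GRing.Zmodule_isComNzRing.Build grpalg gmulA gmulC gmul1 gmulDl gone_neq0.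

Fact gscaleAl (c : rat) (a b : grpalg) : c *: (a * b) = (c *: a) * b.
Proof.
have sE : forall x, c *: x = gmul (mono 0 c) x :> grpalg.
  elim/grpalg_ind=> [|x y IHx IHy|u x]; first by rewrite scaler0 gmul0r.
    by rewrite gmulDr scalerDr IHx IHy.
  rewrite gmulUU add0r; apply/malgP => v.
  by rewrite monalg.mcoeffZ !monalg.mcoeffU mulrnAr.
by rewrite !sE; apply: mulrA.
Qed.

HB.instance Definition _ := GRing.Lmodule_isLalgebra.Build rat grpalg gscaleAl.
HB.instance Definition _ := GRing.Lalgebra_isComAlgebra.Build rat grpalg.

Fact shiftD u v : shift (u + v) = shift u * shift v.
Proof. by rewrite [RHS]gmulUU mulr1. Qed.

End GroupAlgebra.

(* A shift operator E = sum_u E_u T^u acts on functions h : G -> rat by       *)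
(* (T^u h)(x) = h (x + u).                                                    *)

Section ShiftOperators.
Variable G : zmodType.
Implicit Types (E : grpalg G) (h : G -> rat).

Definition sh_act E h : G -> rat :=
  fun x => \sum_(u <- monalg.msupp E) monalg.mcoeff u E * h (x + u).

Fact sh_actw E h x (d : {fset G}) : (monalg.msupp E `<=` d)%fset ->
  sh_act E h x = \sum_(u <- d) monalg.mcoeff u E * h (x + u).
Proof.
move=> le_d; apply: big_fset_incl => // u _ /monalg.mcoeff_outdom ->.
by rewrite mul0r.
Qed.

Lemma sh_actD E F h x : sh_act (E + F) h x = sh_act E h x + sh_act F h x.
Proof.
rewrite (sh_actw _ _ (monalg.msuppD_le E F)).
rewrite (sh_actw _ _ (fsubsetUl _ (monalg.msupp F))).
rewrite (sh_actw _ _ (fsubsetUr (monalg.msupp E) _)) -big_split /=.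
by apply: eq_bigr => u _; rewrite monalg.mcoeffD mulrDl.
Qed.

Lemma sh_act0 h x : sh_act 0 h x = 0.
Proof. by rewrite /sh_act monalg.msupp0 big_seq_fset0. Qed.

Lemma sh_actU u c h x : sh_act (monalg.mkmalgU u c) h x = c * h (x + u).
Proof.
by rewrite (sh_actw _ _ monalg.msuppU_le) big_seq_fset1 monalg.mcoeffUU.
Qed.

Lemma sh_actT u h x : sh_act (shift u) h x = h (x + u).
Proof. by rewrite sh_actU mul1r. Qed.

Lemma sh_actN E h x : sh_act (- E) h x = - sh_act E h x.
Proof. by apply/eqP; rewrite -addr_eq0 -sh_actD addNr sh_act0. Qed.

Lemma sh_actM E F h x : sh_act (E * F) h x = sh_act E (sh_act F h) x.
Proof.
elim/grpalg_ind: E x => [x|a b IHa IHb x|u c].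
- by rewrite mul0r !sh_act0.
- by rewrite mulrDl !sh_actD IHa IHb.
elim/grpalg_ind: F => [x|a b IHa IHb x|v d x].
- by rewrite mulr0 sh_actU !sh_act0 mulr0.
- by rewrite mulrDr sh_actD IHa IHb !sh_actU sh_actD mulrDr.
by rewrite [_ * _]gmulUU !sh_actU mulrA addrA.
Qed.

Definition kills_fun h E : bool := `[< forall x, sh_act E h x = 0 >].

Fact kills_fun_ideal h : ideal_closed (kills_fun h).
Proof.
split; first split.
- by apply/asboolP => x; rewrite sh_act0.
- move=> E F /asboolP hE /asboolP hF; apply/asboolP => x.
  by rewrite sh_actD sh_actN hE hF subrr.
move=> A E /asboolP hE; apply/asboolP => x; rewrite sh_actM.
by rewrite /sh_act big1 // => u _; rewrite -/(sh_act E h _) hE mulr0.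
Qed.

Definition sh_ann h : ideal (grpalg G) := Ideal (kills_fun_ideal h).

End ShiftOperators.

(* A differential operator D = sum_m D_m d^m, written as a polynomial in the  *)
(* partial derivatives, acts on polynomials in as many variables.             *)

Section DifferentialOperators.
Variable r : nat.
Implicit Types (D g : {mpoly rat[r]}).

Definition diff_act D g : {mpoly rat[r]} :=
  \sum_(m <- msupp D) D@_m *: mderivm m g.

Fact diff_actw D g (s : seq 'X_{1..r}) : uniq s -> {subset msupp D <= s} ->
  diff_act D g = \sum_(m <- s) D@_m *: mderivm m g.
Proof.
move=> us le_s; rewrite [RHS](bigID (mem (msupp D))) /=.
rewrite [X in _ + X]big1 ?addr0; last first.
  by move=> m mD; rewrite memN_msupp_eq0 ?scale0r.
rewrite -big_filter; apply: perm_big; apply: uniq_perm.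
- exact: msupp_uniq.
- exact: filter_uniq.
by move=> m; rewrite mem_filter; case: (boolP (m \in _)) => [/le_s ->|].
Qed.

Lemma diff_actD D1 D2 g : diff_act (D1 + D2) g = diff_act D1 g + diff_act D2 g.
Proof.
pose s := undup (msupp D1 ++ msupp D2).
have us : uniq s by exact: undup_uniq.
have s1 : {subset msupp D1 <= s} by move=> m mD; rewrite mem_undup mem_cat mD.
have s2 : {subset msupp D2 <= s}.
  by move=> m mD; rewrite mem_undup mem_cat mD orbT.
have s12 : {subset msupp (D1 + D2) <= s}.
  by move=> m /msuppD_le; rewrite mem_undup.
rewrite (diff_actw _ us s12) (diff_actw _ us s1) (diff_actw _ us s2).
by rewrite -big_split /=; apply: eq_bigr => m _; rewrite mcoeffD scalerDl.
Qed.

Lemma diff_act0 g : diff_act 0 g = 0.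
Proof. by rewrite /diff_act msupp0 big_nil. Qed.

Lemma diff_actZX c m g : diff_act (c *: 'X_[m]) g = c *: mderivm m g.
Proof.
rewrite (@diff_actw _ _ [:: m]) //; last first.
  by move=> k /msuppZ_le; rewrite msuppX.
by rewrite big_seq1 mcoeffZ mcoeffX eqxx mulr1.
Qed.

Lemma diff_actN D g : diff_act (- D) g = - diff_act D g.
Proof. by apply/eqP; rewrite -addr_eq0 -diff_actD addNr diff_act0. Qed.

Lemma diff_act_is_linear D : linear (diff_act D).
Proof.
move=> c g1 g2; rewrite /diff_act scaler_sumr -big_split /=.
by apply: eq_bigr => m _; rewrite linearP scalerDr !scalerA mulrC.
Qed.

Lemma diff_actM D1 D2 g : diff_act (D1 * D2) g = diff_act D1 (diff_act D2 g).
Proof.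
have add0 D : diff_act D 0 = 0.
  by rewrite /diff_act big1 // => m _; rewrite linear0 scaler0.
have addD D a b : diff_act D (a + b) = diff_act D a + diff_act D b.
  by have := diff_act_is_linear D 1 a b; rewrite !scale1r.
elim/mpolyind: D1 g => [g|c m p _ _ IH g]; first by rewrite mul0r !diff_act0.
rewrite mulrDl !diff_actD IH; congr (_ + _) => {IH p}.
elim/mpolyind: D2 => [|e k q _ _ IH]; first by rewrite mulr0 !diff_act0 add0.
rewrite mulrDr !diff_actD addD IH; congr (_ + _) => {IH q}.
rewrite -scalerAl -scalerAr -mpolyXD scalerA !diff_actZX linearZ /= scalerA.
by rewrite addmC mderivmDm.
Qed.

Definition kills_poly g D : bool := diff_act D g == 0.

Fact kills_poly_ideal g : ideal_closed (kills_poly g).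
Proof.
split; first split.
- by apply/eqP; rewrite diff_act0.
- move=> D E /eqP hD /eqP hE.
  by apply/eqP; rewrite diff_actD diff_actN hD hE subrr.
move=> A D /eqP hD; apply/eqP; rewrite diff_actM hD.
by rewrite /diff_act big1 // => m _; rewrite linear0 scaler0.
Qed.

Definition diff_ann g : ideal {mpoly rat[r]} := Ideal (kills_poly_ideal g).

(* The algebra A_g over rat, with its functional [D] |-> (D . g)(0).          *)
Definition diff_alg g := qalg (diff_ann g).

Definition deg_diff g (a : diff_alg g) : rat := (diff_act (repr a) g).@[fun=> 0].

Lemma deg_diffE g D : deg_diff (qproj (diff_ann g) D) = (diff_act D g).@[fun=> 0].
Proof.
have /eqP : repr (qproj (diff_ann g) D) - D \in ideal_pred (diff_ann g).
  by apply/qprojP; rewrite qproj_repr.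
by rewrite /deg_diff diff_actD diff_actN => /subr0_eq ->.
Qed.

End DifferentialOperators.

Section IdealGenerated.
Variables (R : comNzRingType) (X : R -> Prop).

Definition generated (p : R) : bool :=
  `[< exists s : seq (R * R),
        (forall t, t \in s -> X t.2) /\ p = \sum_(t <- s) t.1 * t.2 >].

Fact generated_ideal : ideal_closed generated.
Proof.
have genM a p : p \in generated -> a * p \in generated.
  move=> /asboolP[s [sX ->]]; apply/asboolP.
  exists [seq (a * t.1, t.2) | t <- s]; split=> [t /mapP[t' /sX tX ->] //|].
  by rewrite big_map mulr_sumr; apply: eq_bigr => t _; rewrite mulrA.
split=> //; split; first by apply/asboolP; exists [::]; rewrite big_nil.
move=> p q pX; rewrite -mulN1r => /(genM (-1))/asboolP[s' [s'X ->]].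
move: pX => /asboolP[s [sX ->]]; apply/asboolP; exists (s ++ s').
by split=> [t|]; [rewrite mem_cat => /orP[/sX|/s'X] | rewrite big_cat].
Qed.

Definition ideal_gen : ideal R := Ideal generated_ideal.

End IdealGenerated.

(* Fans.  The lattice N is Z^n (row vectors), M = Hom(N, Z) is the space of   *)
(* column vectors, and N_Q consists of rational row vectors.  A simplicial    *)
(* fan is given by the primitive generators u_rho of its rays, indexed by a   *)
(* finite type R, and by its cones, each encoded by its set of rays.          *)

Record fan_data (R : finType) (n : nat) := FanData {
  ray_gen : R -> 'rV[int]_n;
  cones : {set {set R}}
}.

Definition pairing n (m : 'cV[int]_n) (u : 'rV[int]_n) : int := (u *m m) 0 0.

Section Fan.
Variables (R : finType) (n : nat) (Sigma : fan_data R n).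
Implicit Types (rho : R) (sigma tau : {set R}).

Definition ray_genQ rho : 'rV[rat]_n := map_mx intr (ray_gen Sigma rho).

Definition in_cone sigma (v : 'rV[rat]_n) : Prop :=
  exists c : R -> rat,
    (forall rho, 0 <= c rho) /\ v = \sum_(rho in sigma) c rho *: ray_genQ rho.

Definition unimodular_cone sigma : Prop :=
  exists (B : 'M[int]_n) (f : R -> 'I_n),
    [/\ B \in unitmx, {in sigma &, injective f}
      & {in sigma, forall rho, ray_gen Sigma rho = row (f rho) B}].

(* The faces of a unimodular cone are the cones over the subsets of its set   *)
(* of rays, so that the last condition says that two cones meet in a common   *)
(* face.                                                                      *)
Definition unimodular_fan : Prop :=
  [/\ set0 \in cones Sigma,
      forall rho, [set rho] \in cones Sigma,
      forall sigma tau, sigma \in cones Sigma -> tau \subset sigma ->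
        tau \in cones Sigma,
      forall sigma, sigma \in cones Sigma -> unimodular_cone sigma
    & forall sigma tau, sigma \in cones Sigma -> tau \in cones Sigma ->
        forall v, in_cone sigma v -> in_cone tau v ->
          in_cone (sigma :&: tau) v].

Definition cones_dim (k : nat) : {set {set R}} :=
  [set sigma in cones Sigma | #|sigma| == k].

Definition purely_dimensional (d : nat) : Prop :=
  forall sigma, sigma \in cones Sigma ->
    exists2 tau, tau \in cones_dim d & sigma \subset tau.

(* For tau in Sigma(k-1) and sigma in Sigma(k) containing tau, the set        *)
(* sigma :\: tau has exactly one element, the ray generated by                *)
(* u_(sigma\tau).                                                             *)
Definition weighted_star_sum (k : nat) (w : {set R} -> rat) tau : 'rV[rat]_n :=
  \sum_(sigma in cones_dim k | tau \subset sigma)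
    w sigma *: \sum_(rho in sigma :\: tau) ray_genQ rho.

Definition minkowski_weight (k : nat) (w : {set R} -> rat) : Prop :=
  forall tau, tau \in cones Sigma -> #|tau|.+1 = k ->
    (weighted_star_sum k w tau <= \sum_(rho in tau) <<ray_genQ rho>>)%MS.

Definition balanced_skeleton (k : nat) : Prop :=
  minkowski_weight k (fun=> 1).

(* F, of which only the values on the support of Sigma matter, is linear on   *)
(* each cone and integral at the ray generators.                              *)
Definition piecewise_linear (F : 'rV[rat]_n -> rat) : Prop :=
  (forall sigma, sigma \in cones Sigma -> exists m : 'cV[rat]_n,
     forall v, in_cone sigma v -> F v = (v *m m) 0 0) /\
  (forall rho, exists k : int, F (ray_genQ rho) = k%:~R).

(* PL(Sigma) in coordinates: f stands for sum_rho (f rho) x_rho, that is, for *)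
(* the piecewise linear function with value f rho at u_rho; see PL_extend and *)
(* PL_determined below.                                                       *)
Definition PL := {ffun R -> int}.

Lemma cone_pairing sigma (m : 'cV[rat]_n) (f : R -> rat) (c : R -> rat) :
    {in sigma, forall rho, (ray_genQ rho *m m) 0 0 = f rho} ->
  ((\sum_(rho in sigma) c rho *: ray_genQ rho) *m m) 0 0 =
    \sum_(rho in sigma) c rho * f rho.
Proof.
move=> mf; rewrite mulmx_suml summxE; apply: eq_bigr => rho rhoS.
by rewrite -scalemxAl mxE mf.
Qed.

Lemma gen_in_cone sigma rho : rho \in sigma -> in_cone sigma (ray_genQ rho).
Proof.
move=> rhoS; exists (fun rho' => (rho' == rho)%:R); split=> [rho'|].
  by rewrite ler0n.
rewrite (bigD1 rho) //= eqxx scale1r big1 ?addr0 // => rho' /andP[_ /negPf ->].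
by rewrite scale0r.
Qed.

Lemma PL_determined (F G : 'rV[rat]_n -> rat) :
    piecewise_linear F -> piecewise_linear G ->
    (forall rho, F (ray_genQ rho) = G (ray_genQ rho)) ->
  forall sigma v, sigma \in cones Sigma -> in_cone sigma v -> F v = G v.
Proof.
move=> [Flin _] [Glin _] FG sigma v sS vS; have [c [_ vE]] := vS.
have [[m mF] [m' mG]] := (Flin _ sS, Glin _ sS).
have mE rho : rho \in sigma -> (ray_genQ rho *m m) 0 0 = G (ray_genQ rho).
  by move=> rS; rewrite -FG mF //; apply: gen_in_cone.
have mE' rho : rho \in sigma -> (ray_genQ rho *m m') 0 0 = G (ray_genQ rho).
  by move=> rS; rewrite mG //; apply: gen_in_cone.
rewrite (mF v vS) (mG v vS) vE.
by rewrite !(@cone_pairing _ _ (fun rho => G (ray_genQ rho))).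
Qed.

Lemma PL_extend (f : PL) : unimodular_fan ->
  exists2 F, piecewise_linear F & forall rho, F (ray_genQ rho) = (f rho)%:~R.
Proof.
case=> _ rayS _ uniS capS.
have lin sigma : exists m : 'cV[rat]_n, sigma \in cones Sigma ->
    {in sigma, forall rho, (ray_genQ rho *m m) 0 0 = (f rho)%:~R}.
  case: (boolP (sigma \in _)) => [/uniS[B [g [Bu gi Bg]]]|_]; last by exists 0.
  pose b j : rat := \sum_(rho in sigma | g rho == j) (f rho)%:~R.
  exists (map_mx intr (invmx B) *m \col_j b j) => _ rho rhoS.
  rewrite mulmxA -map_mxM Bg // -row_mul mulmxV // map_row map_mx1 -row_mul mul1mx.
  rewrite !mxE /b (bigD1 rho) ?rhoS ?eqxx //= big1 ?addr0 //.
  by move=> rho' /andP[/andP[r'S /eqP gg] /eqP[]]; apply: gi.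
have [m mP] := choice lin.
pose F v := if [pick sigma in cones Sigma | `[< in_cone sigma v >]] is Some sigma
            then (v *m m sigma) 0 0 else 0.
have FE sigma v : sigma \in cones Sigma -> in_cone sigma v ->
    F v = (v *m m sigma) 0 0.
  move=> sS vS; rewrite /F; case: pickP => [tau|/(_ sigma)]; last first.
    by rewrite sS; case: asboolP.
  case/andP=> tS /asboolP vT; have [c [_ ->]] := capS _ _ tS sS _ vT vS.
  rewrite !(@cone_pairing _ _ (fun rho => (f rho)%:~R)) //.
    by move=> rho; rewrite inE => /andP[_]; apply: mP.
  by move=> rho; rewrite inE => /andP[+ _]; apply: mP.
have FG rho : F (ray_genQ rho) = (f rho)%:~R.
  have r1 : rho \in [set rho] by rewrite inE.
  by rewrite (FE [set rho]) ?mP //; apply: gen_in_cone.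
exists F => //; split=> [sigma sS|rho]; last by exists (f rho).
by exists (m sigma) => v; apply: FE.
Qed.

Definition courant rho : PL := [ffun rho' => (rho' == rho)%:Z].

Definition linPL (m : 'cV[int]_n) : PL :=
  [ffun rho => pairing m (ray_gen Sigma rho)].

(* The star fan at rho.  Its lattice N / Z u_rho is identified with Z^n' by   *)
(* means of a surjection pi : N -> Z^n' of kernel Z u_rho; its rays are the   *)
(* images of the rays rho' != rho spanning a cone with rho.                   *)
Definition star_ray rho : finType :=
  {rho' : R | (rho' != rho) && ([set rho; rho'] \in cones Sigma)}.

Definition lattice_quotient n' (u : 'rV[int]_n) (pi : 'M[int]_(n, n')) : Prop :=
  (forall w : 'rV[int]_n', exists v, v *m pi = w) /\
  (forall v : 'rV[int]_n, v *m pi = 0 <-> exists k : int, v = k *: u).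

Definition star rho n' (pi : 'M[int]_(n, n')) : fan_data (star_ray rho) n' :=
  FanData (fun rho' : star_ray rho => ray_gen Sigma (val rho') *m pi)
          [set sigma : {set star_ray rho} | rho |: (val @: sigma) \in cones Sigma].

(* The restriction of f - m to the cones containing rho; its class modulo     *)
(* Hom(N / Z u_rho, Z) is f^rho when <m, u_rho> = f (u_rho).                  *)
Definition star_restr rho (f : PL) (m : 'cV[int]_n) :
    {ffun star_ray rho -> int} :=
  [ffun rho' => f (val rho') - pairing m (ray_gen Sigma (val rho'))].

End Fan.

Inductive is_ehrhart : forall (R : finType) (n : nat) (Sigma : fan_data R n),
    (PL R -> int) -> Prop :=
| Ehrhart_zero R n (Sigma : fan_data R n) (Ehr : PL R -> int) :
    cones Sigma = [set set0] ->
    (forall f : PL R, Ehr f = 1) ->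
    is_ehrhart Sigma Ehr
| Ehrhart_star R n (Sigma : fan_data R n) (Ehr : PL R -> int)
    (n' : R -> nat) (pi : forall rho, 'M[int]_(n, n' rho))
    (Ehr_star : forall rho, PL (star_ray Sigma rho) -> int) :
    cones Sigma != [set set0] ->
    (forall rho, lattice_quotient (ray_gen Sigma rho) (pi rho)) ->
    (forall rho, is_ehrhart (star Sigma rho (pi rho)) (Ehr_star rho)) ->
    (forall (f : PL R) m, Ehr (f + linPL Sigma m) = Ehr f) ->
    Ehr 0 = 1 ->
    (forall (f : PL R) rho m, pairing m (ray_gen Sigma rho) = f rho ->
      Ehr f - Ehr (f - courant rho) = Ehr_star rho (star_restr Sigma rho f m)) ->
    is_ehrhart Sigma Ehr.

(* From here on the rays are numbered, so as to index polynomial variables.   *)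

Section ChowAndVolume.
Variables (n r : nat) (Sigma : fan_data 'I_r n).

Definition chow_relation (p : {mpoly rat[r]}) : Prop :=
  (exists2 I : {set 'I_r}, I \notin cones Sigma & p = \prod_(i in I) 'X_i) \/
  (exists m : 'cV[int]_n,
     p = \sum_i (pairing m (ray_gen Sigma i))%:~R *: 'X_i).

Definition chow_ring := qalg (ideal_gen chow_relation).

Definition chow_class (p : {mpoly rat[r]}) : chow_ring :=
  qproj (ideal_gen chow_relation) p.

(* The weight corresponding to a functional on the Chow ring.                 *)
Definition weight_of (psi : chow_ring -> rat) (sigma : {set 'I_r}) : rat :=
  psi (\prod_(i in sigma) chow_class 'X_i).

Definition is_degree (d : nat) (deg : {scalar chow_ring}) : Prop :=
  (forall k p, p \is k.-homog -> k != d -> deg (chow_class p) = 0) /\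
  {in cones_dim Sigma d, forall sigma, weight_of deg sigma = 1}.

Definition PL_class (f : PL 'I_r) : chow_ring :=
  \sum_i (f i)%:~R *: chow_class 'X_i.

Definition is_volume_polynomial (d : nat) (deg : {scalar chow_ring})
    (Vol : {mpoly rat[r]}) : Prop :=
  forall f : PL 'I_r,
    Vol.@[fun i => (f i)%:~R] = (d`!%:R)^-1 * deg (PL_class f ^+ d).

End ChowAndVolume.

Section Todd.
Variables (n r : nat) (Sigma : fan_data 'I_r n).
Variables (Ehr : PL 'I_r -> int) (Vol : {mpoly rat[r]}).

Local Notation Sh := (grpalg (PL 'I_r)).
Local Notation A_Vol := (diff_alg Vol).

Definition EhrQ (f : PL 'I_r) : rat := (Ehr f)%:~R.

Definition K_Ehr := qalg (sh_ann EhrQ).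

Definition chi (E : Sh) : rat := sh_act E EhrQ 0.

Definition partial (i : 'I_r) : A_Vol := qproj (diff_ann Vol) 'X_i.

(* phi is the homomorphism of rat-algebras T^(x_rho) |-> 1 / (1 - [d_rho]).     *)
Definition is_phi_geom (phi : {rmorphism Sh -> A_Vol}) : Prop :=
  scalable phi /\ forall i, phi (shift (courant i)) * (1 - partial i) = 1.

Definition descends_to_iso (phi : {rmorphism Sh -> A_Vol}) : Prop :=
  exists2 Phi : {rmorphism K_Ehr -> A_Vol},
    bijective Phi & forall E, Phi (qproj (sh_ann EhrQ) E) = phi E.

Definition is_exceptional_todd (phi : {rmorphism Sh -> A_Vol}) (td : A_Vol) :
    Prop :=
  (exists td', td * td' = 1) /\
  forall E, chi E = deg_diff (td * phi E).

(* The family w of Minkowski weights represents a in A_Vol if it corresponds  *)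
(* to the functional [p] |-> deg (a [p(d)]) on the Chow ring.                 *)
Definition represented_by (a : A_Vol) (w : nat -> {set 'I_r} -> rat) : Prop :=
  (forall k, minkowski_weight Sigma k (w k)) /\
  exists2 psi : {scalar chow_ring Sigma},
    (forall p, psi (chow_class Sigma p) = deg_diff (a * qproj (diff_ann Vol) p))
    & forall k, {in cones_dim Sigma k, forall sigma,
        w k sigma = weight_of psi sigma}.

End Todd.

(* Main.v *)
(* Differentiating Vol gives (D . Vol)(0) = deg [D], so that the relations of
   the Chow ring annihilate Vol.  The pairing (a, b) |-> deg (a b) on A_Vol is
   nondegenerate, and so is (E, F) |-> chi (E F) on K_Ehr; carried over to
   A_Vol by phi, the functional chi is deg (td _) for a unique td, which is a
   unit because the two pairings can be exchanged.  As phi sends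
   1 - T^(- x_rho) to d_rho, the weight of td at a cone sigma is the value at 0
   of the iterated difference of Ehr along the rays of sigma; by the recursion
   defining Ehrhart fans it equals Ehr 0 = 1 for the star of sigma.  Finally,
   every functional on the Chow ring is a Minkowski weight: apply it to the
   linear relation of a form vanishing on tau, multiplied by the monomial of
   tau. *)

Require Import Defs.
From mathcomp Require Import all_boot all_order all_algebra.
From mathcomp Require Import mpoly.
From mathcomp Require monalg.
From HB Require Import structures.
From mathcomp Require Import boolp.

Set Implicit Arguments.
Unset Strict Implicit.
Unset Printing Implicit Defensive.

Import GRing.Theory Num.Theory.

Local Open Scope ring_scope.

(** * Polynomials over the rationals: Taylor coefficients at 0, restriction to lines, vanishing at
    integer points *)

Section Polynomials.
Variable r : nat.
Implicit Types (p q D g : {mpoly rat[r]}) (m : 'X_{1..r}).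

Lemma mnm_neq0 m : m != 0%MM -> exists i, m i != 0%N.
Proof.
case: (pickP (fun i => m i != 0%N)) => [i mi _|m0 /eqP[]]; first by exists i.
by apply/mnmP => i; rewrite mnm0E; have /negbFE/eqP := m0 i.
Qed.

Lemma meval0_coeff p : p.@[fun=> 0] = p@_0%MM.
Proof.
elim/mpolyind: p => [|c m p _ _ IH]; first by rewrite meval0 mcoeff0.
rewrite mevalD mevalZ IH mcoeffD mcoeffZ mcoeffX mevalX; congr (_ * _ + _).
have [->|] := eqVneq m 0%MM; first by rewrite big1 // => i _; rewrite mnm0E expr0.
by move/mnm_neq0 => [i mi]; rewrite (bigD1 i) //= expr0n (negPf mi) mul0r.
Qed.

Lemma taylor_eq0 p : (forall m, p^`M[m].@[fun=> 0] = 0) -> p = 0.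
Proof.
move=> p0; apply/mpolyP => m; rewrite mcoeff0.
have /eqP := p0 m; rewrite meval0_coeff mcoeff_mderivm addm0 mulrn_eq0.
case/orP => [|/eqP //]; rewrite -leqn0 leqNgt => /negP[].
by apply: prodn_gt0 => i; rewrite ffact_gt0.
Qed.

(* The restriction of p to the line through f in the direction of 'X_i. *)
Definition line (f : 'I_r -> rat) (i : 'I_r) : {mpoly rat[r]} -> {poly rat} :=
  mmap (@polyC rat) (fun j => (f j)%:P + (j == i)%:R *: 'X).

Lemma horner_line f i p t :
  (line f i p).[t] = p.@[fun j => f j + (j == i)%:R * t].
Proof.
elim/mpolyind: p => [|c m p _ _ IH]; first by rewrite /line mmap0 horner0 meval0.
rewrite /line mmapD -/(line f i p) hornerD IH mevalD mevalZ mmapZ mmapX mevalX.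
rewrite hornerM hornerC /mmap1 horner_prod; congr (_ * _ + _).
by apply: eq_bigr => j _; rewrite horner_exp hornerD hornerZ hornerC hornerX.
Qed.

(** Both sides are derivations along the ring homomorphism [line f i], so it suffices that they
    agree on variables and that agreement passes to products and linear combinations. *)
Lemma deriv_line f i p : (line f i p)^`() = line f i p^`M(i).
Proof.
pose P q := (line f i q)^`() = line f i q^`M(i).
have lineM q1 q2 : line f i (q1 * q2) = line f i q1 * line f i q2 by exact: rmorphM.
have PM q1 q2 : P q1 -> P q2 -> P (q1 * q2).
  by rewrite /P mderivM lineM derivM => -> ->; rewrite /line mmapD -!/(line f i _) !lineM.
have P1 : P 1.
  by rewrite /P -mpolyC1 mderivC /line mmapC mmap0 derivC.
have PX j : P 'X_j.
  rewrite /P /line mderivX mmapZ !mmapX mmap1U derivD derivC derivZ derivX add0r mnm1E.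
  have [->|_] := eqVneq j i; last by rewrite scale0r mul0r.
  have -> : (U_(i) - U_(i) = 0)%MM by apply/mnmP => k; rewrite mnmBE subnn mnm0E.
  by rewrite mmap11 scale1r mul1r.
rewrite -/(P p); elim/mpolyind: p => [|c m p _ _ IH].
  by rewrite /P mderiv0 /line mmap0 deriv0.
rewrite /P /line mderivD mderivZ !mmapD derivD -/(line f i p) IH; congr (_ + _).
rewrite !mmapZ derivM derivC mul0r add0r; congr (_ * _).
rewrite -/(line f i _) -/(P _) mpolyXE_id; apply: big_ind => // j _.
by elim: (m j) => [|k IHk]; rewrite ?expr0 ?exprS //; apply: PM.
Qed.

Lemma poly_nat_eq0 (p : {poly rat}) : (forall k : nat, p.[k%:R] = 0) -> p = 0.
Proof.
move=> p0; apply/eqP/negPn/negP => /max_poly_roots-/(_ [seq k%:R | k <- iota 0 (size p)]).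
rewrite size_map size_iota ltnn map_inj_uniq ?iota_uniq; last exact: (mulrIn (oner_neq0 _)).
suff -> : all (root p) [seq k%:R | k <- iota 0 (size p)] by move=> /(_ isT isT).
by apply/allP => _ /mapP[k _ ->]; apply/rootP.
Qed.

(** Along a coordinate line through an integer point, such a polynomial has all naturals as roots,
    so its restriction is zero and so is the derivative of the restriction. Hence every partial
    derivative again vanishes at integer points, and all Taylor coefficients at 0 are zero. *)
Lemma mpoly_int_eq0 p :
  (forall f : 'I_r -> int, p.@[fun i => (f i)%:~R] = 0) -> p = 0.
Proof.
have der q i : (forall f : 'I_r -> int, q.@[fun i => (f i)%:~R] = 0) ->
    forall f : 'I_r -> int, q^`M(i).@[fun i => (f i)%:~R] = 0.
  move=> q0 f; pose fQ j : rat := (f j)%:~R.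
  have l0 : line fQ i q = 0.
    apply: poly_nat_eq0 => k; rewrite horner_line.
    rewrite -[RHS](q0 (fun j => f j + (j == i)%:Z * k%:Z)).
    by apply: meval_eq => j; rewrite rmorphD rmorphM.
  have := deriv_line fQ i q; rewrite l0 deriv0 => /(congr1 (horner^~ 0)).
  rewrite horner0 horner_line => e0; rewrite [RHS]e0; apply: meval_eq => j.
  by rewrite mulr0 addr0.
have derm q m : (forall f : 'I_r -> int, q.@[fun i => (f i)%:~R] = 0) ->
    forall f : 'I_r -> int, q^`M[m].@[fun i => (f i)%:~R] = 0.
  move=> q0; rewrite mderivm_foldr.
  by elim: (flatten _) => //= i s IH; apply: der.
by move=> p0; apply: taylor_eq0 => m; apply: (derm p m p0 (fun=> 0)).
Qed.

End Polynomials.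

(** * Volume polynomials attached to a linear functional, and their derivatives *)

Section VolumePolynomial.
Variables (r : nat) (L : {scalar {mpoly rat[r]}}).
Implicit Types (y D : {mpoly rat[r]}) (m : 'X_{1..r}).

(* By Euler's formula, power_poly k y is v |-> L ((sum_i v_i X_i)^k y) / k!, so
   that Vol is power_poly d 1 for L = deg. *)
Fixpoint power_poly k y : {mpoly rat[r]} :=
  if k is k'.+1 then k%:R^-1 *: \sum_i 'X_i * power_poly k' ('X_i * y)
  else (L y)%:MP.

Lemma power_polyE k y v :
  (power_poly k y).@[v] = k`!%:R^-1 * L ((\sum_i v i *: 'X_i) ^+ k * y).
Proof.
elim: k y => [|k IH] y /=; first by rewrite mevalC invr1 expr0 !mul1r.
rewrite mevalZ raddf_sum /=; under eq_bigr => i _.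
  rewrite mevalM mevalXU IH mulrCA -linearZ /=.
  over.
rewrite -mulr_sumr mulrA -invfM -natrM -factS -raddf_sum /=; congr (_ * L _).
rewrite exprSr -mulrA mulr_suml mulr_sumr; apply: eq_bigr => i _.
by rewrite -scalerAl -scalerAr.
Qed.

(** In degree k+1 the product rule gives [power_poly k ('X_i * y)] once from the factors ['X_j], and
    by induction k more times from the remaining sum; the total k+1 cancels the normalising
    factor. *)
Lemma mderiv_power_poly k i y :
  (power_poly k y)^`M(i) =
    if k is k'.+1 then power_poly k' ('X_i * y) else 0.
Proof.
elim: k y => [|k IH] y /=; first by rewrite mderivC.
rewrite mderivZ (raddf_sum (mderiv i)) /=; under eq_bigr => j _.
  rewrite mderivM mderivX IH.
  over.
rewrite big_split /= (bigD1 i) //= mnm1E eqxx scale1r big1 ?addr0; last first.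
  by move=> j ji; rewrite mnm1E (negPf ji) scale0r mul0r.
have -> : (U_(i) - U_(i) = 0)%MM by apply/mnmP => j; rewrite mnmBE subnn mnm0E.
rewrite mpolyX0 mul1r; case: k IH => [|k] IH.
  by rewrite big1 ?addr0 ?scale1r ?invr1 ?scale1r // => j _; rewrite mulr0.
under eq_bigr do rewrite mulrCA.
have -> : \sum_j 'X_j * power_poly k ('X_j * ('X_i * y)) =
    k.+1%:R *: power_poly k.+1 ('X_i * y).
  by rewrite /= scalerA divff ?pnatr_eq0 // scale1r.
rewrite -{1}[power_poly k.+1 _]scale1r -scalerDl -mulrS scalerA.
by rewrite mulVf ?pnatr_eq0 // scale1r.
Qed.

Lemma mderivm_power_poly m k y :
  (power_poly k y)^`M[m] =
    if (mdeg m <= k)%N then power_poly (k - mdeg m) ('X_[m] * y) else 0.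
Proof.
have [n] := ubnP (mdeg m); elim: n m k y => // n IH m k y.
have [->|] := eqVneq m 0%MM.
  by rewrite mdeg0 mderivm0m subn0 mpolyX0 mul1r.
move=> /mnm_neq0[i mi] mn.
have /submK mE : (U_(i) <= m)%MM by rewrite lep1mP.
rewrite -mE mdegD mdeg1 addn1 in mn *.
rewrite addmC mderivmDm mderivmU1m mderiv_power_poly mpolyXD.
case: k => [|k]; first by rewrite linear0.
by rewrite IH // ltnS subSS mulrCA mulrA.
Qed.

(** A monomial operator of degree below d leaves a form of positive degree, which vanishes at 0;
    above d it kills the polynomial; in degree d it leaves the constant [L 'X_[m]]. *)
Lemma diff_act_power_poly d D :
    (forall m, mdeg m != d -> L 'X_[m] = 0) ->
  (diff_act D (power_poly d 1)).@[fun=> 0] = L D.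
Proof.
move=> L0; rewrite [in RHS](mpolyE D) !raddf_sum /=; apply: eq_bigr => m _.
rewrite mevalZ [RHS]linearZ /=; congr (_ * _).
rewrite mderivm_power_poly mulr1; case: (ltngtP (mdeg m) d) => md.
- rewrite power_polyE L0 ?ltn_eqF // big1; last by move=> i _; rewrite scale0r.
  by rewrite expr0n subn_eq0 leqNgt md mul0r linear0 mulr0.
- by rewrite meval0 L0 ?gtn_eqF.
by rewrite md subnn /= mevalC.
Qed.

End VolumePolynomial.

(** * Compatibility of scalars and products in quotient algebras *)

Section QuotientScaling.
Variables (R : comAlgType rat) (I : ideal R).

Lemma qalg_scaleAl c (a b : qalg I) : c *: (a * b) = c *: a * b.
Proof.
have [[x ->] [y ->]] := (qproj_surj a, qproj_surj b).
by rewrite -rmorphM -!linearZ -rmorphM scalerAl.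
Qed.

Lemma qalg_scaleAr c (a b : qalg I) : c *: (a * b) = a * (c *: b).
Proof. by rewrite mulrC qalg_scaleAl mulrC. Qed.

End QuotientScaling.

(** * Poincaré duality for A_g *)

Section PoincareDuality.
Variables (r : nat) (g : {mpoly rat[r]}).
Local Notation A := (diff_alg g).
Local Notation cls := (qproj (diff_ann g)).
Implicit Types (a b : A).

Lemma deg_diff_is_linear : linear_for *%R (@deg_diff r g).
Proof.
move=> c a b; have [[x ->] [y ->]] := (qproj_surj a, qproj_surj b).
rewrite -linearP !deg_diffE diff_actD mevalD -mul_mpolyC diff_actM.
by rewrite -[c%:MP]mulr1 mul_mpolyC -mpolyX0 diff_actZX mderivm0m mevalZ.
Qed.

HB.instance Definition _ :=
  GRing.isLinear.Build rat A rat *%R (@deg_diff r g) deg_diff_is_linear.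

Lemma mderivm_diff_act m D : (diff_act D g)^`M[m] = diff_act ('X_[m] * D) g.
Proof. by rewrite diff_actM -['X_[m]]scale1r diff_actZX scale1r. Qed.

(** Pairing [D] with monomials gives the derivatives of D . g at 0, so D . g vanishes once all of
    these do. *)
Lemma deg_diff_nondegenerate a : (forall b, deg_diff (a * b) = 0) -> a = 0.
Proof.
have [D ->] := qproj_surj a => D0.
rewrite -(raddf0 cls); apply/qprojP; rewrite subr0; apply/eqP/taylor_eq0 => m.
by rewrite mderivm_diff_act -deg_diffE mulrC rmorphM D0.
Qed.

(* Monomials of degree at least msize g kill g, hence those of smaller degree
   span A. *)
Local Notation idx := 'X_{1..r < msize g}.

Definition comb (v : 'cV[rat]_#|{: idx}|) : A :=
  \sum_i v i 0 *: cls 'X_[enum_val i : idx].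

Lemma comb_is_linear : linear comb.
Proof.
move=> c u v; rewrite /comb scaler_sumr -big_split; apply: eq_bigr => i _.
by rewrite !mxE scalerDl scalerA.
Qed.

HB.instance Definition _ := GRing.isLinear.Build rat _ A _ comb comb_is_linear.

Lemma comb_surj a : exists v, a = comb v.
Proof.
have [D ->] := qproj_surj a.
elim/mpolyind: D => [|c m p _ _ [v IH]]; first by exists 0; rewrite !raddf0.
suff [u uE] : exists u, cls 'X_[m] = comb u.
  by exists (c *: u + v); rewrite !linearP /= IH uE.
have [mg|mg] := ltnP (mdeg m) (msize g).
  exists (delta_mx (enum_rank (BMultinom mg)) 0).
  rewrite /comb (bigD1 (enum_rank (BMultinom mg))) //= big1.
    by rewrite addr0 mxE !eqxx scale1r enum_rankK.
  by move=> i /negPf ne; rewrite mxE ne scale0r.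
exists 0; rewrite raddf0 -(raddf0 cls); apply/qprojP; rewrite subr0.
rewrite -['X_[m]]scale1r; apply/eqP; rewrite diff_actZX scale1r.
apply/mpolyP => l; rewrite mcoeff_mderivm mcoeff0 memN_msupp_eq0 ?mul0rn //.
by apply: contraL mg => /msize_mdeg_lt; rewrite mdegD -ltnNge; apply/leq_trans/leq_addr.
Qed.

(** Linear algebra with the Gram matrix [G] of [psi] on the finite spanning family of monomials. The
    family may be dependent, so [G] may be singular and c comes from membership of a row in its row
    space. *)
Lemma nondegenerate_represents (psi chi : {scalar A}) :
    (forall a, (forall b, psi (a * b) = 0) -> a = 0) ->
  exists c, forall a, chi a = psi (c * a).
Proof.
move=> psi_nd.
pose e (i : 'I_#|{: idx}|) : A := cls 'X_[enum_val i : idx].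
pose G := \matrix_(i, j) psi (e i * e j).
pose w := \row_j chi (e j).
have chiE v : chi (comb v) = (w *m v) 0 0.
  rewrite raddf_sum mxE; apply: eq_bigr => i _.
  by rewrite [LHS]linearZ /= mxE mulrC.
have psiE u v : psi (comb u * comb v) = (u^T *m (G *m v)) 0 0.
  rewrite mulr_suml raddf_sum mxE; apply: eq_bigr => i _.
  rewrite /= -qalg_scaleAl [LHS]linearZ /= mxE; congr (_ * _).
  rewrite mulr_sumr raddf_sum mxE; apply: eq_bigr => j _.
  by rewrite /= -qalg_scaleAr [LHS]linearZ /= mxE mulrC.
(* A column killed by [G] gives an element that [psi] pairs to zero with everything, hence zero; [w]
   therefore kills it too. *)
have /submxP[c wE] : (w <= G)%MS.
  rewrite submxE; apply/eqP/matrixP => i j; rewrite ord1 [RHS]mxE.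
  suff v0 : comb (col j (cokermx G)) = 0.
    by have := chiE (col j (cokermx G)); rewrite v0 raddf0 colE mulmxA -colE mxE => <-.
  apply: psi_nd => b; have [u ->] := comb_surj b.
  by rewrite mulrC psiE colE (mulmxA G) mulmx_coker mul0mx mulmx0 mxE.
exists (comb c^T) => a; have [v ->] := comb_surj a.
by rewrite chiE wE psiE trmxK mulmxA.
Qed.

End PoincareDuality.

(** * Iterated differences of Ehrhart functions *)

Section IteratedDifferences.
Variable R : finType.
Implicit Types (s : seq R) (f : PL R).

Fixpoint nabla s (h : PL R -> rat) f : rat :=
  if s is rho :: s' then nabla s' h f - nabla s' h (f - courant rho) else h f.

(** Applies the difference along the last ray to the function itself, the form in which the Ehrhart
    recursion enters. *)
Lemma nabla_rcons s rho h f :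
  nabla (rcons s rho) h f = nabla s (nabla [:: rho] h) f.
Proof. by elim: s f => //= rho' s IH f; rewrite !IH. Qed.

Lemma sh_act_prod s h f :
  sh_act (\prod_(rho <- s) (1 - shift (- courant rho))) h f = nabla s h f.
Proof.
elim: s f => [|rho s IH] f; first by rewrite big_nil [LHS]sh_actT addr0.
by rewrite big_cons sh_actM sh_actD sh_actN [sh_act 1 _ _]sh_actT sh_actT addr0 !IH.
Qed.

End IteratedDifferences.

(** Subtracting Courant functions of rays other than [rho] preserves [f rho = 0], where the linear
    form 0 may be used to restrict to the star; this restriction takes Courant functions to Courant
    functions. *)
Lemma nabla_star (R : finType) n (Sigma : fan_data R n) rho
    (s : seq (star_ray Sigma rho)) (h : PL R -> rat)
    (h' : PL (star_ray Sigma rho) -> rat) (f : PL R) :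
    (forall f : PL R, f rho = 0 -> h f = h' (star_restr Sigma rho f 0)) ->
  f rho = 0 -> nabla (map val s) h f = nabla s h' (star_restr Sigma rho f 0).
Proof.
move=> hE; elim: s f => [|a s IH] f f0 /=; first exact: hE.
rewrite IH // IH; last first.
  have /andP[/negPf ne _] := valP a.
  by rewrite !ffunE f0 eq_sym ne subr0.
congr (_ - nabla _ _ _); apply/ffunP => b.
by rewrite !ffunE /pairing mulmx0 mxE !subr0 (inj_eq val_inj).
Qed.

(** By induction on the Ehrhart structure: the difference along the last ray [rho] turns [Ehr] into
    the Ehrhart function of the star at [rho], where the other rays span a cone. Closure under faces
    is carried along because it passes to stars. *)
Lemma nabla_ehrhart (R : finType) n (Sigma : fan_data R n) (Ehr : PL R -> int) :
    is_ehrhart Sigma Ehr ->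
    (forall sigma tau : {set R}, sigma \in cones Sigma -> tau \subset sigma ->
       tau \in cones Sigma) ->
  forall s, uniq s -> [set rho in s] \in cones Sigma ->
    nabla s (fun f => (Ehr f)%:~R) 0 = 1.
Proof.
elim=> {R n Sigma Ehr} [R n Sigma Ehr cE E1 _ s _|].
  rewrite cE inE => /eqP s0; case: s s0 => [|a s] s0; first by rewrite /= E1.
  by have := in_set0 a; rewrite -s0 inE mem_head.
move=> R n Sigma Ehr n' pi Ehr' _ _ _ IH _ E0 Erec faces.
elim/last_ind=> [_ _|s rho _]; first by rewrite /= E0.
rewrite rcons_uniq => /andP[rs us] sS.
have sray a : a \in s -> (a != rho) && ([set rho; a] \in cones Sigma).
  move=> ain; apply/andP; split; first by apply: contraNneq rs => <-.
  apply: faces sS _; apply/subsetP => b; rewrite !inE mem_rcons inE.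
  by case/orP => /eqP ->; rewrite ?eqxx ?ain ?orbT.
(* The list [s] read as rays of the star; by [sray] no entry is lost. *)
pose t : seq (star_ray Sigma rho) := pmap insub s.
have tE : map val t = s.
  rewrite /t pmap_filter; last by move=> a; rewrite insubK.
  by apply/all_filterP/allP => a /sray h; rewrite insubT.
rewrite nabla_rcons -[in LHS]tE (@nabla_star _ _ _ _ _ _ (fun f => (Ehr' rho f)%:~R)).
- have -> : star_restr Sigma rho 0 0 = 0 :> PL _.
    by apply/ffunP => b; rewrite !ffunE /pairing mulmx0 mxE subr0.
  apply: IH.
  + move=> sigma tau; rewrite !inE => sC ts; apply: faces sC _.
    by apply/setUS/imsetS.
  + by rewrite -(map_inj_uniq val_inj) tE.
  rewrite inE; suff -> : rho |: val @: [set a in t] = [set a in rcons s rho] by [].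
  apply/setP => b; rewrite !inE mem_rcons inE; congr (_ || _).
  rewrite -[in RHS]tE; apply/imsetP/mapP => -[a at_ ->]; exists a => //.
    by rewrite inE in at_.
  by rewrite inE.
- move=> f f0; rewrite /= -rmorphB /= (Erec f rho 0) //.
  by rewrite /pairing mulmx0 mxE f0.
by rewrite ffunE.
Qed.

(** Compose [f] with any section of [q]: the value does not depend on the section, whence
    linearity. *)
Lemma scalar_descends (U V : lmodType rat) (q : U -> V) (f : {scalar U}) :
    linear q -> (forall v, exists u, q u = v) ->
    (forall u, q u = 0 -> f u = 0) ->
  exists psi : {scalar V}, forall u, psi (q u) = f u.
Proof.
move=> qlin /choice[g gK] f0.
have gE u : f (g (q u)) = f u.
  apply/eqP; rewrite -subr_eq0 -raddfB; apply/eqP/f0.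
  by rewrite addrC -scaleN1r qlin gK scaleN1r addNr.
have lin : linear_for *%R (f \o g).
  move=> c v w; rewrite /= -[in LHS](gK v) -[in LHS](gK w) -qlin gE.
  by rewrite linearP.
pose psi : {scalar V} := HB.pack (f \o g) (GRing.isLinear.Build rat V rat *%R (f \o g) lin).
by exists psi.
Qed.

(** * Functionals on the Chow ring as Minkowski weights *)

Section Chow.
Variables (n r : nat) (Sigma : fan_data 'I_r n).
Local Notation x_ i := (chow_class Sigma 'X_i).

Lemma chow_class_generator p : chow_relation Sigma p -> chow_class Sigma p = 0.
Proof.
move=> rel; rewrite /chow_class -(raddf0 (qproj (ideal_gen (chow_relation Sigma)))).
apply/qprojP; rewrite subr0; apply/asboolP; exists [:: (1, p)].
by split=> [t|]; rewrite ?inE ?big_seq1 ?mul1r // => /eqP ->.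
Qed.

(** The defining relations come from integral forms; a rational form is a rational combination of
    the coordinate forms [delta_mx j 0]. *)
Lemma chow_linear_relation (m : 'cV[rat]_n) :
  \sum_i (ray_genQ Sigma i *m m) 0 0 *: x_ i = 0.
Proof.
transitivity (\sum_j m j 0 *: chow_class Sigma
    (\sum_i (pairing (delta_mx j 0) (ray_gen Sigma i))%:~R *: 'X_i)).
  under [RHS]eq_bigr => j _.
    rewrite /chow_class raddf_sum scaler_sumr /=.
    over.
  rewrite exchange_big; apply: eq_bigr => i _ /=.
  rewrite mxE scaler_suml; apply: eq_bigr => j _.
  rewrite linearZ /= scalerA /pairing -colE !mxE.
  by rewrite mulrC.
rewrite big1 // => j _; rewrite chow_class_generator ?scaler0 //.
by right; exists (delta_mx j 0).
Qed.

Lemma weight_of_minkowski (psi : {scalar chow_ring Sigma}) k :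
  minkowski_weight Sigma k (weight_of psi).
Proof.
move=> tau tauS tauk; rewrite submxE; apply/eqP/matrixP => i j.
(* Membership in the span of [tau] is tested on the columns of [cokermx U]: each is a linear form
   [m] vanishing on [tau], with values [l] on the rays. *)
set U := (\sum_(rho in tau) _)%MS; rewrite (ord1 i) [RHS]mxE.
pose m := col j (cokermx U).
have mE (v : 'rV_n) : (v *m m) 0 0 = (v *m cokermx U) 0 j.
  by rewrite !mxE; apply: eq_bigr => k' _; rewrite mxE.
pose l rho := (ray_genQ Sigma rho *m m) 0 0.
have l_tau rho : rho \in tau -> l rho = 0.
  move=> rhot; have : (ray_genQ Sigma rho <= U)%MS.
    by apply: (sumsmx_sup rho) => //; rewrite genmxE.
  by rewrite /l mE submxE => /eqP ->; rewrite mxE.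
transitivity ((weighted_star_sum Sigma k (weight_of psi) tau *m m) 0 0).
  by rewrite mE.
have x_tau0 : psi (\prod_(i in tau) x_ i * \sum_rho l rho *: x_ rho) = 0.
  by rewrite chow_linear_relation mulr0 raddf0.
rewrite -[RHS]x_tau0 mulr_sumr raddf_sum /weighted_star_sum.
rewrite mulmx_suml summxE.
transitivity (\sum_(sigma in cones_dim Sigma k | tau \subset sigma)
    \sum_(rho in sigma :\: tau) weight_of psi sigma * l rho).
  apply: eq_bigr => sigma _; rewrite -scalemxAl mxE mulmx_suml summxE mulr_sumr.
  by apply: eq_bigr.
rewrite (exchange_big_dep predT) //=; apply: eq_bigr => rho _.
rewrite -qalg_scaleAr [RHS]linearZ /=.
(* Rays of [tau] drop out because [l] vanishes there, so only squarefree monomials remain. *)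
have [rhot|rhot] := boolP (rho \in tau).
  rewrite l_tau // mul0r big1 // => sigma /andP[_].
  by rewrite inE rhot.
transitivity (l rho * \sum_(sigma in cones_dim Sigma k | sigma == rho |: tau) weight_of psi sigma).
  rewrite mulr_sumr; apply: eq_big => [sigma|sigma _]; last by rewrite mulrC.
  rewrite -andbA; apply: andb_id2l; rewrite inE => /andP[_ /eqP sk].
  apply/andP/eqP => [[ts]|->]; last by rewrite subsetUr !inE eqxx rhot.
  rewrite inE => /andP[_ rhos]; apply/esym/eqP; rewrite eqEcard.
  by rewrite subUset sub1set rhos ts cardsU1 rhot sk -tauk add1n ltnSn.
have -> : \prod_(i in tau) x_ i * x_ rho = \prod_(i in rho |: tau) x_ i.
  by rewrite big_setU1 //= mulrC.
congr (_ * _).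
(* Either [rho |: tau] is the one k-dimensional cone containing both, or its monomial is a relation
   of the Chow ring. *)
have [rS|rS] := boolP (rho |: tau \in cones Sigma).
  rewrite (big_pred1 (rho |: tau)) // => sigma; rewrite inE /=.
  have [->|_] := eqVneq sigma (rho |: tau); last by rewrite andbF.
  by rewrite rS cardsU1 rhot -tauk add1n eqxx.
rewrite big1 => [|sigma /andP[+ /eqP sE]]; last by rewrite inE sE (negPf rS).
have -> : \prod_(i in rho |: tau) x_ i = chow_class Sigma (\prod_(i in rho |: tau) 'X_i).
  by rewrite /chow_class rmorph_prod.
rewrite chow_class_generator ?raddf0 //.
by left; exists (rho |: tau).
Qed.

End Chow.

(** * The surjection from the Chow ring to A_Vol *)

Section ChowToDiff.
Variables (n r d : nat) (Sigma : fan_data 'I_r n).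
Variables (deg : {scalar chow_ring Sigma}) (Vol : {mpoly rat[r]}).
Hypotheses (deg_spec : is_degree d deg) (Vol_spec : is_volume_polynomial d deg Vol).

Lemma deg_diff_chow p :
  (diff_act p Vol).@[fun=> 0] = deg (chow_class Sigma p).
Proof.
pose L : {scalar {mpoly rat[r]}} := deg \o qproj (ideal_gen (chow_relation Sigma)).
(* Both polynomials have the same values on PL, that is, at integer points. *)
have -> : Vol = power_poly L d 1.
  apply/eqP; rewrite -subr_eq0; apply/eqP/mpoly_int_eq0 => f.
  have := Vol_spec [ffun i => f i].
  rewrite mevalB power_polyE mulr1.
  under [X in X = _ -> _]meval_eq => i do rewrite ffunE.
  move=> ->; rewrite /PL_class /L /= rmorphXn raddf_sum /=.
  apply/eqP; rewrite subr_eq0; apply/eqP; congr (_ * deg (_ ^+ _)).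
  by apply: eq_bigr => i _; rewrite ffunE linearZ.
rewrite diff_act_power_poly // => m md.
by apply: deg_spec.1 md; rewrite dhomogX.
Qed.

(** All multiples of [p] by monomials also vanish in the Chow ring, hence have degree 0; these
    degrees are the derivatives of p . Vol at 0. *)
Lemma chow_class_diff p :
  chow_class Sigma p = 0 -> qproj (diff_ann Vol) p = 0.
Proof.
move=> p0; rewrite -(raddf0 (qproj (diff_ann Vol))); apply/qprojP; rewrite subr0.
apply/eqP/taylor_eq0 => m.
rewrite mderivm_diff_act deg_diff_chow.
have -> : chow_class Sigma ('X_[m] * p) = chow_class Sigma 'X_[m] * chow_class Sigma p.
  exact: rmorphM.
by rewrite p0 mulr0 raddf0.
Qed.

End ChowToDiff.

Lemma scale_shift0 (G : zmodType) c : c *: shift (0 : G) = monalg.mkmalgU 0 c.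
Proof.
by apply/monalg.malgP => v; rewrite monalg.mcoeffZ !monalg.mcoeffU mulrnAr mulr1.
Qed.

(** * The Euler characteristic functional on shift operators *)

Section Chi.
Variables (r : nat) (Ehr : PL 'I_r -> int).

Lemma chi_is_linear : linear_for *%R (chi Ehr).
Proof.
move=> c E F; rewrite /chi sh_actD -[E in c *: E]mul1r scalerAl sh_actM.
by rewrite -[1]/(shift 0) scale_shift0 sh_actU addr0.
Qed.

HB.instance Definition _ :=
  GRing.isLinear.Build rat (grpalg (PL 'I_r)) rat *%R (chi Ehr) chi_is_linear.

Lemma chi_shift u E : chi Ehr (shift u * E) = sh_act E (EhrQ Ehr) u.
Proof. by rewrite /chi sh_actM sh_actT add0r. Qed.

End Chi.

(** * Existence and uniqueness of the exceptional Todd class *)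

Section ExceptionalTodd.
Variables (r : nat) (Ehr : PL 'I_r -> int) (Vol : {mpoly rat[r]}).
Variables (phi : {rmorphism grpalg (PL 'I_r) -> diff_alg Vol}).
Hypotheses (phi_spec : is_phi_geom phi) (phi_iso : descends_to_iso Ehr phi).

Lemma phi_surj a : exists E, phi E = a.
Proof.
have [Phi [Psi _ PhiK] PhiE] := phi_iso.
by have [E EE] := qproj_surj (Psi a); exists E; rewrite -PhiE -EE PhiK.
Qed.

Lemma phi_eq0 E : phi E = 0 <-> (forall f, sh_act E (EhrQ Ehr) f = 0).
Proof.
have [Phi /bij_inj Phi_inj PhiE] := phi_iso.
split=> [|E0].
  rewrite -PhiE -(rmorph0 Phi) => /Phi_inj; rewrite -(raddf0 (qproj _)).
  by move/qprojP; rewrite subr0 => /asboolP.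
rewrite -PhiE -(rmorph0 Phi); congr (Phi _).
by rewrite -(raddf0 (qproj _)); apply/qprojP; rewrite subr0; apply/asboolP.
Qed.

Lemma phi_linear : linear phi.
Proof. by move=> c E F; rewrite rmorphD phi_spec.1. Qed.

(** The image of T^(-x_i) is inverse to that of T^(x_i), as is 1 - d_i; inverses are unique. *)
Lemma phi_difference i : phi (1 - shift (- courant i)) = partial Vol i.
Proof.
have phiN : phi (shift (- courant i)) = 1 - partial Vol i.
  rewrite -[LHS]mulr1 -[X in _ * X = _](phi_spec.2 i) mulrA -rmorphM -shiftD addNr.
  by rewrite [phi _]rmorph1 mul1r.
by rewrite rmorphB rmorph1 phiN opprB addrC subrK.
Qed.

Lemma exceptional_todd_exists : exists td, is_exceptional_todd Ehr phi td.
Proof.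
have [psi psiE] : exists psi : {scalar diff_alg Vol}, forall E, psi (phi E) = chi Ehr E.
  apply: scalar_descends phi_linear phi_surj _ => E /phi_eq0 E0; exact: E0.
(* Testing against the image of T^f gives the value at f of E applied to Ehr, so E annihilates
   Ehr. *)
have psi_nd a : (forall b, psi (a * b) = 0) -> a = 0.
  have [E <-] := phi_surj a => E0; apply/phi_eq0 => f.
  by rewrite -chi_shift -psiE rmorphM mulrC E0.
have [td tdE] := nondegenerate_represents psi (@deg_diff_nondegenerate _ Vol).
(* With the roles exchanged, deg b = psi (td' b) = deg (td td' b) for all b, so td' is the inverse
   of td. *)
have [td' td'E] := nondegenerate_represents (@deg_diff r Vol) psi_nd.
exists td; split; last by move=> E; rewrite -tdE psiE.
exists td'; apply/eqP; rewrite -subr_eq0; apply/eqP/deg_diff_nondegenerate => b.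
by rewrite mulrBl mul1r -mulrA raddfB /= -tdE -td'E subrr.
Qed.

Lemma exceptional_todd_unique td td' :
  is_exceptional_todd Ehr phi td -> is_exceptional_todd Ehr phi td' -> td' = td.
Proof.
move=> [_ tdE] [_ td'E]; apply/eqP; rewrite -subr_eq0; apply/eqP.
apply: deg_diff_nondegenerate => b; have [E <-] := phi_surj b.
by rewrite mulrBl raddfB /= -tdE -td'E subrr.
Qed.

End ExceptionalTodd.

Theorem proposition5p15 (n r d : nat) (Sigma : fan_data 'I_r n)
    (Sigma_fan : unimodular_fan Sigma)
    (Ehr : PL 'I_r -> int) (Sigma_ehrhart : is_ehrhart Sigma Ehr)
    (Sigma_pure : purely_dimensional Sigma d)
    (Sigma_balanced : balanced_skeleton Sigma d)
    (deg : {scalar chow_ring Sigma}) (deg_spec : is_degree d deg)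
    (Vol : {mpoly rat[r]}) (Vol_spec : is_volume_polynomial d deg Vol)
    (phi : {rmorphism grpalg (PL 'I_r) -> diff_alg Vol})
    (phi_spec : is_phi_geom phi)
    (phi_iso : descends_to_iso Ehr phi) :
  (exists td : diff_alg Vol,
     [/\ is_exceptional_todd Ehr phi td,
         forall td', is_exceptional_todd Ehr phi td' -> td' = td
       & represented_by Sigma td (fun _ _ => 1)]) /\
  (forall k, balanced_skeleton Sigma k).
Proof.
have [td tdP] := exceptional_todd_exists phi_spec phi_iso.
pose f p := deg_diff (td * qproj (diff_ann Vol) p).
have f_lin : linear_for *%R f.
  by move=> c p q; rewrite /f linearP mulrDr -qalg_scaleAr linearP.
pose psi0 : {scalar {mpoly rat[r]}} :=
  HB.pack f (GRing.isLinear.Build rat {mpoly rat[r]} rat *%R f f_lin).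
have [psi psiE] : exists psi : {scalar chow_ring Sigma}, forall p,
    psi (chow_class Sigma p) = deg_diff (td * qproj (diff_ann Vol) p).
  apply: (@scalar_descends _ _ _ psi0).
  - exact: linearP.
  - by move=> a; have [p ->] := qproj_surj a; exists p.
  by move=> p /(chow_class_diff deg_spec Vol_spec) p0; rewrite /= /f p0 mulr0 raddf0.
(* The monomial of [sigma] maps to a product of [partial]s, the image under [phi] of the product of
   the 1 - T^(-x_i); on it [chi] is an iterated difference of Ehr at 0. *)
have w1 sigma : sigma \in cones Sigma -> weight_of psi sigma = 1.
  move=> sS; have [_ _ faces _ _] := Sigma_fan.
  rewrite /weight_of /chow_class -rmorph_prod psiE rmorph_prod /=.
  under eq_bigr do rewrite -/(partial Vol _) -(phi_difference phi_spec).
  rewrite -rmorph_prod -tdP.2 -big_enum /chi sh_act_prod.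
  apply: (nabla_ehrhart Sigma_ehrhart faces); first exact: enum_uniq.
  by have -> : [set rho in enum sigma] = sigma by apply/setP => i; rewrite inE mem_enum.
(* The weight of [psi] is Minkowski and equals 1 on every cone. *)
have skel k : balanced_skeleton Sigma k.
  move=> tau tauS tauk; have := weight_of_minkowski psi tauS tauk.
  rewrite /weighted_star_sum; under eq_bigr => sigma.
    by rewrite inE => /andP[/andP[sS _] _]; rewrite w1 //; over.
  by [].
split=> //; exists td; split=> // [td'|]; first exact: exceptional_todd_unique tdP.
split=> //; exists psi => // k sigma; rewrite inE => /andP[sS _].
by rewrite w1.
Qed.
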